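(* For every positive integer $k$ there is a constant $c_k>0$, depending only on $k$, such that the following holds. Let $G$ be a finite group and let $\mathcal{C}$ be a cover of $G$ of size $k$ (that is, a collection of $k$ subsets of $G$ whose union is $G$). Then there is a set $A\in\mathcal{C}$ such that there are at least $c_k|G|^2$ quadruples $(x,y,xy,yx)\in A^4$, i.e. at least $c_k|G|^2$ pairs $(x,y)\in G^2$ with $x,y,xy,yx\in A$. *)

(* Defs.v *)
From mathcomp Require Import all_boot all_order all_algebra all_fingroup.
From mathcomp Require Import reals.

Set Implicit Arguments.
Unset Strict Implicit.
Unset Printing Implicit Defensive.

(* The quadruple (x, y, xy, yx) is determined by (x, y), so the quadruples of
   this shape lying in A^4 are counted by pairs. *)
Definition product_pairs (gT : finGroupType) (A : {set gT}) : {set gT * gT} :=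
  [set p : gT * gT | [&& p.1 \in A, p.2 \in A, (p.1 * p.2)%g \in A
                       & (p.2 * p.1)%g \in A]].

(* Main.v *)
Require Import Defs.
From mathcomp Require Import all_boot all_order all_algebra all_fingroup.
From mathcomp Require Import reals.
From mathcomp Require Import ring lra.

Set Implicit Arguments.
Unset Strict Implicit.
Unset Printing Implicit Defensive.

Import Order.TTheory GRing.Theory Num.Theory.
Local Open Scope ring_scope.

(* A graph regularity argument (a weighted form of triangle removal) shows that
   a dense [E] in [T * T] contains a positive proportion of the corners
   (u, v), (ug, v), (ug, vg).  Apply it to the sets
   [E_h = {(u, v) : u^-1 h_j v \in A_j for all j}], where [h] ranges over [T^k]:
   on a corner, [y_j = (ug)^-1 h_j v] has [y_j], [g y_j] and [y_j g] in [A_j],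
   with one common [g].  Averaging over [h], for which the [y_j] become
   independent and uniform, a positive proportion [d] of the [g] satisfies
   "[y], [gy], [yg] in [A_j] for at least [d |T|] elements [y]" for all dense
   sets [A_j] simultaneously.  Choosing the density threshold at a gap, the
   remaining sets of the cover are too small to contain most of these [g], so
   many of them lie in some dense [A_j], which then contains the quadruples. *)

(** * Conditional expectation with respect to an equivalence relation on a finite set *)

Section ConditionalExpectation.
Variables (R : realFieldType) (X : finType).
Implicit Types (e : rel X) (f h : X -> R).

Definition class_of e x := [set y | e x y].

Definition cexp e f x : R := (\sum_(y in class_of e x) f y) / #|class_of e x|%:R.

Definition invariant_fun e h := forall x y, e x y -> h x = h y.

Variable e : rel X.
Hypothesis eE : equivalence_rel e.

Let e_refl x : e x x. Proof. by have [] := eE x x x. Qed.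
Let e_sym x y : e x y = e y x.
Proof.
apply/idP/idP => h.
  by have [_ /(_ h)<-] := eE x y x.
by have [_ /(_ h)<-] := eE y x y.
Qed.

Lemma class_of_eq x y : e x y -> class_of e x = class_of e y.
Proof. by move=> h; apply/setP=> z; rewrite !inE; have [_ ->] := eE x y z. Qed.

Lemma card_class_gt0 x : 0 < #|class_of e x|%:R :> R.
Proof. by rewrite ltr0n; apply/card_gt0P; exists x; rewrite inE. Qed.

Lemma cexp_invariant f : invariant_fun e (cexp e f).
Proof. by move=> x y exy; rewrite /cexp (class_of_eq exy). Qed.

(** Exchange the sums: each [y] is counted once for every point of its class, with weight one over
    the size of that class. Averaging is thus the orthogonal projection onto the invariant
    functions. *)
Lemma sum_cexpM f h : invariant_fun e h ->
  \sum_x cexp e f x * h x = \sum_x f x * h x.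
Proof.
move=> hI.
have -> : \sum_x cexp e f x * h x
    = \sum_x \sum_(y in class_of e x) f y * h y / #|class_of e y|%:R.
  apply: eq_bigr => x _; rewrite /cexp !mulr_suml; apply: eq_bigr => y.
  by rewrite inE => exy; rewrite (class_of_eq exy) (hI _ _ exy) mulrAC.
rewrite (exchange_big_dep predT) //=; apply: eq_bigr => y _.
rewrite (eq_bigl (mem (class_of e y))); last by move=> x; rewrite !inE e_sym.
by rewrite sumr_const -[LHS]mulr_natr mulfVK// lt0r_neq0// card_class_gt0.
Qed.

Lemma sum_cexp f : \sum_x cexp e f x = \sum_x f x.
Proof.
have := @sum_cexpM f (fun=> 1) (fun _ _ _ => erefl).
by under eq_bigr do rewrite mulr1; under [RHS]eq_bigr do rewrite mulr1.
Qed.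

Lemma cexp_ge0 f x : (forall y, 0 <= f y) -> 0 <= cexp e f x.
Proof. by move=> f0; rewrite divr_ge0 ?ler0n// sumr_ge0. Qed.

Lemma cexp_le1 f x : (forall y, f y <= 1) -> cexp e f x <= 1.
Proof.
move=> f1; rewrite ler_pdivrMr ?card_class_gt0// mul1r.
by rewrite -sum1_card natr_sum; apply: ler_sum.
Qed.

Lemma sum_class_cexp f x :
  \sum_(y in class_of e x) f y = cexp e f x * #|class_of e x|%:R.
Proof. by rewrite mulfVK// lt0r_neq0// card_class_gt0. Qed.

End ConditionalExpectation.

(** Nested projections: [cexp e f] is invariant under the finer [e'], so its inner product with
    [cexp e' f] is the one with [f], which is its own squared norm. *)
Lemma pythagoras_cexp (R : realFieldType) (X : finType) (e e' : rel X) (f : X -> R) :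
  equivalence_rel e -> equivalence_rel e' -> subrel e' e ->
  \sum_x (cexp e' f x - cexp e f x) ^+ 2
    = \sum_x cexp e' f x ^+ 2 - \sum_x cexp e f x ^+ 2.
Proof.
move=> eE eE' sub.
have H1 := sum_cexpM eE f (cexp_invariant eE f).
have inv' : invariant_fun e' (cexp e f).
  by move=> x y /sub; apply: cexp_invariant.
have H2 := sum_cexpM eE' f inv'.
have -> : \sum_x (cexp e' f x - cexp e f x) ^+ 2 = \sum_x cexp e' f x ^+ 2
   + \sum_x cexp e f x * cexp e f x - 2 * \sum_x cexp e' f x * cexp e f x.
  rewrite mulr_sumr -big_split /= -sumrB.
  by apply: eq_bigr => x _; ring.
rewrite H2 -H1.
have -> : \sum_x cexp e f x ^+ 2 = \sum_x cexp e f x * cexp e f x by [].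
by ring.
Qed.

(** * Partitions of a vertex set generated by finitely many subsets *)

Section Cells.
Variable V : finType.
Implicit Types (L M : seq {set V}).

(** The classes are the atoms of the Boolean algebra generated by [L]. Coding a partition by
    generators turns refinement into concatenation of lists. *)
Definition same_cell L : rel V :=
  fun x y => all (fun S : {set V} => (x \in S) == (y \in S)) L.

Definition same_box L : rel (V * V) :=
  fun p q => same_cell L p.1 q.1 && same_cell L p.2 q.2.

Definition cell L (x : V) : {set V} := class_of (same_cell L) x.

Lemma same_cell_equiv L : equivalence_rel (same_cell L).
Proof.
move=> x y z; split; first by apply/allP => S _.
move/allP => h; apply: eq_in_all => S /h /eqP ->; by [].
Qed.

Lemma same_box_equiv L : equivalence_rel (same_box L).
Proof.
move=> x y z; rewrite /same_box; split.
  by rewrite (same_cell_equiv L z.1 z.1 z.1).1 (same_cell_equiv L z.2 z.2 z.2).1.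
move=> /andP[h1 h2].
by rewrite ((same_cell_equiv L _ _ _).2 h1) ((same_cell_equiv L _ _ _).2 h2).
Qed.

Lemma same_box_cat L M : subrel (same_box (M ++ L)) (same_box L).
Proof.
by move=> p q; rewrite /same_box /same_cell !all_cat => /andP[/andP[_ ->] /andP[_ ->]].
Qed.

Lemma class_same_box L p : class_of (same_box L) p = setX (cell L p.1) (cell L p.2).
Proof. by apply/setP=> q; rewrite !inE. Qed.

(** Each cell contributes exactly [1], and a cell is determined by its membership vector [sg].
    Through Markov's inequality this bounds the number of points in small cells. *)
Lemma sum_inv_card_cell (R : realFieldType) L :
  \sum_x #|cell L x|%:R^-1 <= (2 ^ size L)%:R :> R.
Proof.
pose sg x : (size L).-tuple bool := map_tuple (fun S : {set V} => x \in S) (in_tuple L).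
have sgE x y : same_cell L x y = (sg x == sg y).
  rewrite -val_eqE /= /same_cell; elim: L {sg} => //= S L ->.
  by rewrite eqseq_cons.
rewrite (partition_big sg predT) //=.
have -> : (2 ^ size L)%N = #|{: (size L).-tuple bool}| by rewrite card_tuple card_bool.
rewrite -sum1_card natr_sum; apply: ler_sum => t _.
have [/existsP[x /eqP xt]|/existsPn no] := boolP [exists x, sg x == t]; last first.
  by rewrite big_pred0 // => x; apply/negbTE/no.
rewrite (eq_big (mem (cell L x)) (fun=> #|cell L x|%:R^-1)) => [|y|y /eqP yt].
- by rewrite sumr_const -[leLHS]mulr_natr mulVf // lt0r_neq0 ?card_class_gt0 //; apply: same_cell_equiv.
- by rewrite /= /cell inE sgE xt eq_sym.
- congr (_%:R^-1); rewrite /cell; congr #|pred_of_set _|; apply: class_of_eq.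
    exact: same_cell_equiv.
  by rewrite sgE yt xt.
Qed.

End Cells.

(** * Energy increment and weak regularity *)

Section Energy.
Variables (R : realFieldType) (V I : finType) (F : I -> V * V -> R).
Hypothesis F01 : forall i p, 0 <= F i p <= 1.
Implicit Types (L M : seq {set V}).

Definition box_mean L i := cexp (same_box L) (F i).

Definition energy L := \sum_i \sum_p box_mean L i p ^+ 2.

(** One-sided Frieze-Kannan regularity, in the cut norm: on no rectangle does a function fall far
    below its box means. This is the direction that a lower bound for triangles uses. *)
Definition regular eps L := [forall i, forall S : {set V}, forall T : {set V},
  \sum_(p in setX S T) (box_mean L i p - F i p) <= eps * #|V|%:R ^+ 2].

Lemma box_mean01 L i p : 0 <= box_mean L i p <= 1.
Proof.
rewrite cexp_ge0 ?cexp_le1 // => [|q|q]; first exact: same_box_equiv.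
  by case/andP: (F01 i q).
by case/andP: (F01 i q).
Qed.

Lemma energy_le L : energy L <= #|I|%:R * #|V|%:R ^+ 2.
Proof.
have -> : #|V|%:R ^+ 2 = #|{: V * V}|%:R :> R by rewrite card_prod natrM.
rewrite /energy -natrM -card_prod.
rewrite pair_big /= -sum1_card natr_sum; apply: ler_sum => -[i p] _ /=.
by rewrite exprn_ile1 //; case/andP: (box_mean01 L i p).
Qed.

Lemma energy_catB L M : energy (M ++ L) - energy L =
  \sum_i \sum_p (box_mean (M ++ L) i p - box_mean L i p) ^+ 2.
Proof.
rewrite -sumrB; apply: eq_bigr => i _; rewrite pythagoras_cexp //.
- exact: same_box_equiv.
- exact: same_box_equiv.
- exact: same_box_cat.
Qed.

(** Adjoin the two sides of a violating rectangle. The change [D] of the box means correlates with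
    the indicator [u] of the rectangle, so [D] has large squared norm, and by Pythagoras that norm
    is an energy gain. *)
Lemma energy_increment eps L : 0 <= eps -> ~~ regular eps L ->
  exists S T, energy L + eps ^+ 2 * #|V|%:R ^+ 2 <= energy ([:: S; T] ++ L).
Proof.
move=> eps0 /forallPn[i] /forallPn[S] /forallPn[T]; rewrite -ltNge => irr.
exists S, T; rewrite addrC -lerBrDr energy_catB.
set L' := [:: S; T] ++ L.
pose D p := box_mean L' i p - box_mean L i p.
pose u p : R := (p \in setX S T)%:R.
apply: (@le_trans _ _ (\sum_p D p ^+ 2)); last first.
  rewrite (bigD1 i) //= lerDl; apply: sumr_ge0 => j _.
  by apply: sumr_ge0 => p _; apply: sqr_ge0.
(* [S] and [T] belong to [L'], so [u] is constant on its boxes; against [u], the [L'] box means may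
   then be replaced by [F i] itself. *)
have uI : invariant_fun (same_box L') u.
  move=> p q; rewrite /same_box /= => /andP[/andP[/eqP hS _]] /and3P[_ /eqP hT _].
  by rewrite /u !inE hS hT.
have DE : \sum_p D p * u p < - (eps * #|V|%:R ^+ 2).
  suff -> : \sum_p D p * u p = - \sum_(p in setX S T) (box_mean L i p - F i p).
    by rewrite ltrN2.
  under eq_bigr do rewrite mulrBl.
  rewrite sumrB (sum_cexpM (same_box_equiv _) _ uI) -sumrB -sumrN [RHS]big_mkcond.
  apply: eq_bigr => p _; rewrite -mulrBl /u; case: ifP => _; last by rewrite mulr0.
  by rewrite mulr1 opprB.
(* Cauchy-Schwarz, in the form [0 <= (D + eps)^2] on the support of [u]. *)
have : \sum_p (- (2 * eps) * (D p * u p) - eps ^+ 2) <= \sum_p D p ^+ 2.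
  apply: ler_sum => p _; rewrite /u; case: (p \in _); last first.
    by rewrite !mulr0 sub0r (@le_trans _ _ 0) ?sqr_ge0 // oppr_le0 sqr_ge0.
  by have := sqr_ge0 (D p + eps); rewrite mulr1; lra.
apply: le_trans; rewrite sumrB -mulr_sumr sumr_const card_prod.
rewrite -[X in _ - X]mulr_natr natrM.
set s := \sum_p D p * u p in DE *; set n := #|V|%:R in DE *.
have : 0 <= eps * (- (eps * n ^+ 2) - s) by rewrite mulr_ge0 // subr_ge0 ltW.
by lra.
Qed.

End Energy.

(** The energy is at most [c * #|V| ^ 2], and each failure of regularity gains [eps ^ 2 * #|V| ^ 2]
    at the price of two sets, so fewer than [N] failures can occur. The bound [K] is uniform in the
    initial list [L]. *)
Lemma exists_regular (R : archiRealFieldType) (c : nat) (eps : R) : 0 < eps ->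
  exists K : nat, forall (V I : finType) (F : I -> V * V -> R) (L : seq {set V}),
    #|I| = c -> (0 < #|V|)%N -> (forall i p, 0 <= F i p <= 1) ->
    exists M, (size M <= K)%N /\ regular F eps (M ++ L).
Proof.
move=> eps0; pose N := (Num.truncn (c%:R / eps ^+ 2)).+1.
exists (2 * N)%N => V I F L cI V0 F01.
have : (exists M, (size M <= 2 * N)%N /\ regular F eps (M ++ L)) \/
   (exists M, (size M <= 2 * N)%N /\ N%:R * eps ^+ 2 * #|V|%:R ^+ 2 <= energy F (M ++ L)).
  elim: N => [|N [[M [sM rM]]|[M [sM eM]]]].
  - right; exists [::]; split=> //; rewrite !mul0r.
    by apply: sumr_ge0 => i _; apply: sumr_ge0 => p _; apply: sqr_ge0.
  - by left; exists M; split => //; rewrite (leq_trans sM) // leq_mul2l leqnSn.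
  have [rM|nrM] := boolP (regular F eps (M ++ L)).
    by left; exists M; split => //; rewrite (leq_trans sM) // leq_mul2l leqnSn.
  have [S [T h]] := energy_increment (ltW eps0) nrM.
  right; exists ([:: S; T] ++ M); split; first by rewrite /= mulnS !ltnS.
  by rewrite -catA; apply: le_trans h; rewrite -natr1; lra.
case=> // -[M [_ eM]]; exfalso.
have := le_trans eM (energy_le F01 _); rewrite cI.
rewrite ler_pM2r ?exprn_gt0 ?ltr0n // leNgt -ltr_pdivrMr ?exprn_gt0 //.
by rewrite truncnS_gt.
Qed.

(** * Counting weighted triangles between three copies of a vertex set *)

Section Triangles.
Variables (R : realFieldType) (V : finType).
Implicit Types (f g h D : V * V -> R) (u v : V -> R).

Definition triangles f g h := \sum_a \sum_b \sum_c f (a, b) * g (a, c) * h (b, c).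

Lemma sum_setX D (A B : {set V}) :
  \sum_(p in setX A B) D p = \sum_(x in A) \sum_(y in B) D (x, y).
Proof. by rewrite pair_big; apply: eq_big => [p|[x y] _] //=; rewrite inE. Qed.

(* A linear form on the cube [0, 1]^V is maximal at a vertex. *)
Lemma weighted_sum_le u v : (forall x, 0 <= u x <= 1) ->
  \sum_x u x * v x <= \sum_(x in [set x | 0 <= v x]) v x.
Proof.
move=> u01; rewrite [leRHS]big_mkcond; apply: ler_sum => x _; rewrite inE.
have /andP[u0 u1] := u01 x; case: ifPn; first by move=> v0; rewrite ler_piMl.
by rewrite -ltNge => /ltW v0; rewrite mulr_ge0_le0.
Qed.

(** The form is linear in [u] and in [v] separately, so each can be pushed to the indicator of a set
    in turn. *)
Lemma cut_bilinear_le D K u v :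
  (forall x, 0 <= u x <= 1) -> (forall x, 0 <= v x <= 1) ->
  (forall S T : {set V}, \sum_(p in setX S T) D p <= K) ->
  \sum_x \sum_y u x * v y * D (x, y) <= K.
Proof.
move=> u01 v01 DK.
have -> : \sum_x \sum_y u x * v y * D (x, y) = \sum_x u x * \sum_y v y * D (x, y).
  by apply: eq_bigr => x _; rewrite mulr_sumr; apply: eq_bigr => y _; rewrite mulrA.
apply: le_trans (weighted_sum_le _ u01) _; set S := [set x | _].
rewrite exchange_big /=; under eq_bigr do rewrite -mulr_sumr.
apply: le_trans (weighted_sum_le _ v01) _; set T := [set x | _].
rewrite exchange_big /= -sum_setX; exact: DK.
Qed.

(** Telescoping: replace one factor at a time. With the vertex opposite to the replaced edge fixed,
    the two other factors have the form [u x * v y], so the cut bound costs [K] for each such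
    vertex. *)
Lemma triangles_le f g h f' g' h' K :
  (forall p, 0 <= f p <= 1) -> (forall p, 0 <= g p <= 1) ->
  (forall p, 0 <= g' p <= 1) -> (forall p, 0 <= h' p <= 1) ->
  (forall S T : {set V}, \sum_(p in setX S T) (f' p - f p) <= K) ->
  (forall S T : {set V}, \sum_(p in setX S T) (g' p - g p) <= K) ->
  (forall S T : {set V}, \sum_(p in setX S T) (h' p - h p) <= K) ->
  triangles f' g' h' <= triangles f g h + 3 * K * #|V|%:R.
Proof.
move=> f1 g1 g1' h1' Kf Kg Kh.
have B1 : triangles f' g' h' - triangles f g' h' <= K * #|V|%:R.
  rewrite -sumrB; under eq_bigr do rewrite -sumrB.
  have -> : \sum_a \sum_b (\sum_c f' (a, b) * g' (a, c) * h' (b, c)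
       - \sum_c f (a, b) * g' (a, c) * h' (b, c))
     = \sum_c \sum_a \sum_b g' (a, c) * h' (b, c) * (f' (a, b) - f (a, b)).
    rewrite [RHS]exchange_big; apply: eq_bigr => a _ /=.
    rewrite [RHS]exchange_big; apply: eq_bigr => b _ /=.
    by rewrite -sumrB; apply: eq_bigr => c _; ring.
  rewrite mulr_natr -sumr_const; apply: ler_sum => c _.
  exact: (@cut_bilinear_le (fun p => f' p - f p)).
have B2 : triangles f g' h' - triangles f g h' <= K * #|V|%:R.
  rewrite -sumrB; under eq_bigr do rewrite -sumrB.
  have -> : \sum_a \sum_b (\sum_c f (a, b) * g' (a, c) * h' (b, c)
       - \sum_c f (a, b) * g (a, c) * h' (b, c))
     = \sum_b \sum_a \sum_c f (a, b) * h' (b, c) * (g' (a, c) - g (a, c)).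
    rewrite [RHS]exchange_big; apply: eq_bigr => a _ /=; apply: eq_bigr => b _ /=.
    by rewrite -sumrB; apply: eq_bigr => c _; ring.
  rewrite mulr_natr -sumr_const; apply: ler_sum => b _.
  exact: (@cut_bilinear_le (fun p => g' p - g p)).
have B3 : triangles f g h' - triangles f g h <= K * #|V|%:R.
  rewrite -sumrB; under eq_bigr do rewrite -sumrB.
  have -> : \sum_a \sum_b (\sum_c f (a, b) * g (a, c) * h' (b, c)
       - \sum_c f (a, b) * g (a, c) * h (b, c))
     = \sum_a \sum_b \sum_c f (a, b) * g (a, c) * (h' (b, c) - h (b, c)).
    apply: eq_bigr => a _ /=; apply: eq_bigr => b _ /=.
    by rewrite -sumrB; apply: eq_bigr => c _; ring.
  rewrite mulr_natr -sumr_const; apply: ler_sum => a _.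
  exact: (@cut_bilinear_le (fun p => h' p - h p)).
lra.
Qed.

(* If some factor is at most [b / 2], its deviation makes the left-hand side
   nonpositive. *)
Lemma prod_near_ge (b x y z : R) (d0 d1 d2 : R) : 0 < b ->
  0 <= x -> 0 <= y -> 0 <= z -> b <= d0 -> b <= d1 -> b <= d2 ->
  (b / 2) ^+ 3 * (1 - 4 / b ^+ 2 * ((x - d0) ^+ 2 + (y - d1) ^+ 2 + (z - d2) ^+ 2))
    <= x * y * z.
Proof.
move=> b0 x0 y0 z0 h0 h1 h2.
have b20 : 0 < b / 2 by lra.
have key t d : b <= d -> t < b / 2 -> 1 <= 4 / b ^+ 2 * (t - d) ^+ 2.
  move=> bd tb; rewrite mulrAC ler_pdivlMr ?exprn_gt0 // mul1r.
  by nra.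
have pos t d : 0 <= 4 / b ^+ 2 * (t - d) ^+ 2 by rewrite mulr_ge0 ?sqr_ge0 // divr_ge0 ?sqr_ge0.
have xyz0 : 0 <= x * y * z by rewrite !mulr_ge0.
have p0 := pos x d0; have p1 := pos y d1; have p2 := pos z d2.
rewrite !(mulrDr (4 / b ^+ 2)); set P0 := 4 / _ * _ in p0 *; set P1 := 4 / _ * _ in p1 *; set P2 := 4 / _ * _ in p2 *.
have neg : 1 <= P0 + P1 + P2 -> (b / 2) ^+ 3 * (1 - (P0 + P1 + P2)) <= x * y * z.
  by move=> P; apply: le_trans xyz0; rewrite mulr_ge0_le0 ?exprn_ge0 ?subr_le0 // ltW.
have [xb|xb] := ltP x (b / 2); first by apply: neg; have := key _ _ h0 xb; rewrite -/P0; lra.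
have [yb|yb] := ltP y (b / 2); first by apply: neg; have := key _ _ h1 yb; rewrite -/P1; lra.
have [zb|zb] := ltP z (b / 2); first by apply: neg; have := key _ _ h2 zb; rewrite -/P2; lra.
apply: (@le_trans _ _ ((b / 2) ^+ 3)).
  by rewrite ler_piMr ?exprn_ge0 ?(ltW b20) //; lra.
have b2 := ltW b20.
rewrite !exprSr expr0 mul1r; apply: ler_pM => //; first exact: mulr_ge0.
exact: ler_pM.
Qed.

(** Average [prod_near_ge] over the box. Each variance contributes at most
    [4 / b ^ 2 * (b ^ 2 / 24) = 1 / 6], which leaves an average factor of at least [1 / 2]. *)
Lemma triangles_box_ge b (d0 d1 d2 : R) f g h (U W Z : {set V}) : 0 < b ->
  (forall p, 0 <= f p) -> (forall p, 0 <= g p) -> (forall p, 0 <= h p) ->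
  b <= d0 -> b <= d1 -> b <= d2 ->
  \sum_(p in setX U W) (f p - d0) ^+ 2 <= b ^+ 2 / 24 * #|setX U W|%:R ->
  \sum_(p in setX U Z) (g p - d1) ^+ 2 <= b ^+ 2 / 24 * #|setX U Z|%:R ->
  \sum_(p in setX W Z) (h p - d2) ^+ 2 <= b ^+ 2 / 24 * #|setX W Z|%:R ->
  (b / 2) ^+ 3 / 2 * (#|U|%:R * #|W|%:R * #|Z|%:R) <= triangles f g h.
Proof.
move=> b0 f0 g0 h0 b0' b1 b2; rewrite !cardsX !natrM => vf vg vh.
pose t a b c := f (a, b) * g (a, c) * h (b, c).
have t0 x y z : 0 <= t x y z by rewrite !mulr_ge0.
apply: (@le_trans _ _ (\sum_(x in U) \sum_(y in W) \sum_(z in Z) t x y z)); last first.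
  have wid (A : {set V}) (s : V -> R) : (forall x, 0 <= s x) ->
      \sum_(x in A) s x <= \sum_x s x.
    by move=> s0; rewrite big_mkcond; apply: ler_sum => x _; case: ifP.
  apply: le_trans (wid _ _ _) _.
    by move=> x; apply: sumr_ge0 => y _; apply: sumr_ge0.
  apply: ler_sum => x _; apply: le_trans (wid _ _ _) _.
    by move=> y; apply: sumr_ge0.
  by apply: ler_sum => y _; apply: wid.
pose k := 4 / b ^+ 2.
pose e0 x y := (f (x, y) - d0) ^+ 2.
pose e1 x y := (g (x, y) - d1) ^+ 2.
pose e2 x y := (h (x, y) - d2) ^+ 2.
apply: (@le_trans _ _ (\sum_(x in U) \sum_(y in W) \sum_(z in Z)
   ((b / 2) ^+ 3 * (1 - k * (e0 x y + e1 x z + e2 y z))))); last first.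
  by do 3!(apply: ler_sum => ? _); apply: prod_near_ge.
have -> : \sum_(x in U) \sum_(y in W) \sum_(z in Z)
   ((b / 2) ^+ 3 * (1 - k * (e0 x y + e1 x z + e2 y z)))
  = (b / 2) ^+ 3 * (#|U|%:R * #|W|%:R * #|Z|%:R - k * (
     \sum_(p in setX U W) (f p - d0) ^+ 2 * #|Z|%:R
   + \sum_(p in setX U Z) (g p - d1) ^+ 2 * #|W|%:R
   + \sum_(p in setX W Z) (h p - d2) ^+ 2 * #|U|%:R)).
  rewrite !sum_setX /=.
  have -> : \sum_(x in W) \sum_(y in Z) (h (x, y) - d2) ^+ 2 * #|U|%:R
      = \sum_(x in U) \sum_(y in W) \sum_(z in Z) e2 y z.
    rewrite sumr_const -[RHS]mulr_natr mulr_suml; apply: eq_bigr => y _.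
    by rewrite mulr_suml.
  have -> : \sum_(x in U) \sum_(y in Z) (g (x, y) - d1) ^+ 2 * #|W|%:R
      = \sum_(x in U) \sum_(y in W) \sum_(z in Z) e1 x z.
    by apply: eq_bigr => x _; rewrite sumr_const -[RHS]mulr_natr mulr_suml.
  have -> : \sum_(x in U) \sum_(y in W) (f (x, y) - d0) ^+ 2 * #|Z|%:R
      = \sum_(x in U) \sum_(y in W) \sum_(z in Z) e0 x y.
    by do 2!(apply: eq_bigr => ? _); rewrite sumr_const -[RHS]mulr_natr.
  have -> : #|U|%:R * #|W|%:R * #|Z|%:R = \sum_(x in U) \sum_(y in W) \sum_(z in Z) 1 :> R.
    under eq_bigr do under eq_bigr do rewrite sumr_const.
    by under eq_bigr do rewrite sumr_const; rewrite sumr_const -!mulrnA !natrM; ring.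
  have split (s s' : V -> V -> V -> R) c : \sum_(x in U) \sum_(y in W) \sum_(z in Z)
     (c * s x y z + s' x y z) = c * (\sum_(x in U) \sum_(y in W) \sum_(z in Z) s x y z)
     + \sum_(x in U) \sum_(y in W) \sum_(z in Z) s' x y z.
    rewrite mulr_sumr -big_split; apply: eq_bigr => x _ /=.
    rewrite mulr_sumr -big_split; apply: eq_bigr => y _ /=.
    by rewrite mulr_sumr -big_split.
  have := split (fun x y z => 1 - k * (e0 x y + e1 x z + e2 y z)) (fun _ _ _ => 0) ((b / 2) ^+ 3) => /=.
  have -> : \sum_(x in U) \sum_(y in W) \sum_(z in Z) 0 = 0 :> R.
    by rewrite big1 // => x _; rewrite big1 // => y _; rewrite big1.
  rewrite addr0; under eq_bigr do under eq_bigr do under eq_bigr do rewrite addr0.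
  move=> ->; congr (_ * _).
  have -> : \sum_(x in U) \sum_(y in W) \sum_(z in Z) (1 - k * (e0 x y + e1 x z + e2 y z))
    = \sum_(x in U) \sum_(y in W) \sum_(z in Z) (- k * e0 x y + (- k * e1 x z + (- k * e2 y z + 1))).
    by do 3!(apply: eq_bigr => ? _); ring.
  by rewrite !split; ring.
rewrite -!mulr_suml.
rewrite -[leLHS]mulrA ler_pM2l ?exprn_gt0 //; last by lra.
set s0 := \sum_(p in _) _ in vf *; set s1 := \sum_(p in _) _ in vg *; set s2 := \sum_(p in _) _ in vh *.
have kE : k * (b ^+ 2 / 24) = 6^-1.
  by rewrite /k; field; rewrite lt0r_neq0.
have k0 : 0 < k by rewrite divr_gt0 // exprn_gt0.
move: k kE k0 => k kE k0.
have bnd s x y z : s <= b ^+ 2 / 24 * (x%:R * y%:R) -> k * (s * z%:R) <= 6^-1 * (x%:R * y%:R * z%:R).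
  move=> le_s; rewrite -kE -(mulrA k) ler_pM2l // mulrA.
  exact: ler_wpM2r.
have := bnd _ _ _ #|Z| vf; have := bnd _ _ _ #|W| vg; have := bnd _ _ _ #|U| vh.
rewrite !mulrDr.
by nra.
Qed.

End Triangles.

(** * Cleaning: a point whose images all lie in dense, stable and large boxes *)

Section GoodPoint.
Variables (R : realFieldType) (V I : finType) (F : I -> V * V -> R).
Hypothesis F01 : forall i p, 0 <= F i p <= 1.
Variables (b g t eta : R) (L M : seq {set V}).
Hypotheses (b0 : 0 < b) (g0 : 0 < g) (t0 : 0 < t).

Let n : R := #|V|%:R.

Let dev i p : R := cexp (same_box L)
  (fun q => (box_mean F (M ++ L) i q - box_mean F L i q) ^+ 2) p.

(** The first two conditions feed [triangles_box_ge], applied to the box means over [M ++ L] on the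
    [L]-box of [p]; the last two make the resulting count a positive proportion of [n ^ 3]. *)
Definition good_at i p := [&& b <= box_mean F L i p, dev i p <= g,
  t * n <= #|cell L p.1|%:R & t * n <= #|cell L p.2|%:R].

(* Dominates [F i p] wherever [good_at] fails, by Markov's inequality. *)
Let cost i p : R := F i p * (box_mean F L i p < b)%R%:R + g^-1 * dev i p
  + t * n * #|cell L p.1|%:R^-1 + t * n * #|cell L p.2|%:R^-1.

Let dev_ge0 i p : 0 <= dev i p.
Proof. by apply: cexp_ge0 => q; apply: sqr_ge0. Qed.

Let n_ge0 : 0 <= n. Proof. exact: ler0n. Qed.

Let tnV_ge0 x : 0 <= t * n * #|cell L x|%:R^-1 :> R.
Proof. by rewrite !mulr_ge0 ?invr_ge0 ?ler0n // ltW. Qed.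

Let cost_ge0 i p : 0 <= cost i p.
Proof.
have /andP[F0 _] := F01 i p.
by rewrite !addr_ge0 // mulr_ge0 // ?ler0n // invr_ge0 ltW.
Qed.

Let le_cost i p : ~~ good_at i p -> F i p <= cost i p.
Proof.
have /andP[F0 F1] := F01 i p.
have d0 := dev_ge0 i p; have c1 := tnV_ge0 p.1; have c2 := tnV_ge0 p.2.
have gd0 : 0 <= g^-1 * dev i p by rewrite mulr_ge0 // invr_ge0 ltW.
have f0 : 0 <= F i p * (box_mean F L i p < b)%R%:R by rewrite mulr_ge0 ?ler0n.
have small x : #|cell L x|%:R < t * n -> 1 <= t * n * #|cell L x|%:R^-1.
  by move=> lt; rewrite ler_pdivlMr ?mul1r ?ltW // card_class_gt0 //; apply: same_cell_equiv.
rewrite /cost !negb_and -!ltNge => /or4P[h|h|h|h].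
- by rewrite h mulr1 -!addrA lerDl !addr_ge0.
- have : 1 <= g^-1 * dev i p by rewrite mulrC ler_pdivlMr // mul1r ltW.
  by lra.
- by have := small _ h; lra.
- by have := small _ h; lra.
Qed.

Let sum_cost i : \sum_p cost i p <= (b + 2 * t * (2 ^ size L)%:R) * n ^+ 2
  + g^-1 * \sum_p (box_mean F (M ++ L) i p - box_mean F L i p) ^+ 2.
Proof.
rewrite /cost !big_split /=.
have S1 : \sum_p F i p * (box_mean F L i p < b)%R%:R <= b * n ^+ 2.
  (* The condition [box_mean F L i p < b] is constant on boxes, so [F i] may be replaced by its box
     mean, which is below [b] wherever the indicator is nonzero. *)
  rewrite -(@sum_cexpM _ _ (same_box L)); last first.
  - by move=> p q /(cexp_invariant (same_box_equiv L) (F i)) e; rewrite /box_mean e.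
  - exact: same_box_equiv.
  have -> : b * n ^+ 2 = \sum_(p : V * V) b.
    by rewrite sumr_const card_prod -mulr_natr natrM expr2.
  apply: ler_sum => p _; case: ltP => h; last by rewrite mulr0 ltW.
  by rewrite mulr1 ltW.
have S2 : \sum_p g^-1 * dev i p = g^-1 * \sum_p (box_mean F (M ++ L) i p - box_mean F L i p) ^+ 2.
  by rewrite -mulr_sumr sum_cexp //; apply: same_box_equiv.
have Sc := @sum_inv_card_cell V R L.
have S3 : \sum_(p : V * V) t * n * #|cell L p.1|%:R^-1 <= t * (2 ^ size L)%:R * n ^+ 2.
  rewrite -(pair_bigA _ (fun x y : V => t * n * #|cell L x|%:R^-1)) /= exchange_big /=.
  rewrite sumr_const -[leLHS]mulr_natr -mulr_sumr -/n.
  have : 0 <= t * n * n * ((2 ^ size L)%:R - \sum_x #|cell L x|%:R^-1).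
    by rewrite !mulr_ge0 ?subr_ge0 // ltW.
  by lra.
have S4 : \sum_(p : V * V) t * n * #|cell L p.2|%:R^-1 <= t * (2 ^ size L)%:R * n ^+ 2.
  rewrite -(pair_bigA _ (fun x y : V => t * n * #|cell L y|%:R^-1)) /=.
  rewrite sumr_const -[leLHS]mulr_natr -mulr_sumr -/n.
  have : 0 <= t * n * n * ((2 ^ size L)%:R - \sum_x #|cell L x|%:R^-1).
    by rewrite !mulr_ge0 ?subr_ge0 // ltW.
  by lra.
by rewrite S2; lra.
Qed.

(** Otherwise every [p] in [E] has an [i] with [1 = F i (q i p) <= cost i (q i p)]. Each [q i] is a
    permutation of [V * V], so [#|E|] would be at most the total cost, which is below
    [a * n ^ 2]. *)
Lemma exists_good_point (E : {set V * V}) (q : I -> V * V -> V * V) (a : R) :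
  (0 < #|V|)%N -> (forall i, injective (q i)) ->
  (forall i p, p \in E -> F i (q i p) = 1) ->
  energy F (M ++ L) <= energy F L + eta * n ^+ 2 ->
  #|I|%:R * (b + 2 * t * (2 ^ size L)%:R) + g^-1 * eta < a ->
  a * n ^+ 2 <= #|E|%:R ->
  exists2 p, p \in E & forall i, good_at i (q i p).
Proof.
move=> V0 qI FE en ab aE.
have [/existsP[p /andP[pE /forallP gp]]|/existsPn bad] :=
  boolP [exists p, (p \in E) && [forall i, good_at i (q i p)]]; first by exists p.
exfalso; have : #|E|%:R <= \sum_i \sum_p cost i p.
  apply: (@le_trans _ _ (\sum_i \sum_p cost i (q i p))); last first.
    by apply: ler_sum => i _; rewrite [leRHS](reindex_inj (qI i)).
  rewrite exchange_big -sum1_card natr_sum big_mkcond /=; apply: ler_sum => p _.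
  case: ifP => pE; last by apply: sumr_ge0.
  have := bad p; rewrite pE /= => /forallPn[i gi].
  rewrite (bigD1 i) //= -[leLHS]addr0 lerD ?sumr_ge0 //.
  by rewrite -(FE i p pE) le_cost.
apply/negP; rewrite -ltNge; apply: lt_le_trans aE.
apply: (@le_lt_trans _ _ ((#|I|%:R * (b + 2 * t * (2 ^ size L)%:R) + g^-1 * eta) * n ^+ 2)); last first.
  by rewrite ltr_pM2r // exprn_gt0 // ltr0n.
apply: (le_trans (ler_sum _ (fun i _ => sum_cost i))).
rewrite big_split /= sumr_const -mulr_sumr -energy_catB //.
rewrite (mulrDl (_ * _)) -[_ *+ #|I|]mulr_natl mulrA lerD2l -mulrA ler_pM2l ?invr_gt0 //.
by rewrite lerBlDl.
Qed.

End GoodPoint.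

(** * Corners in the square of a finite group, by regularity on two levels *)

Section Corners.
Variables (R : archiRealFieldType).
Implicit Type T : finGroupType.

(* [T] carries three vertex classes, and the point (a, b) of [E] is the triangle
   with vertices [a], [b] and [a b^-1]; [corner_fun E i] is the set of its edges
   of type [i], parametrised by end points. *)
Definition corner_fun T (E : {set T * T}) (i : option bool) (p : T * T) : R :=
  match i with
  | None => (p \in E)%:R
  | Some true => ((p.1, (p.2^-1 * p.1)%g) \in E)%:R
  | Some false => (((p.2 * p.1)%g, p.1) \in E)%:R
  end.

Definition side T (i : option bool) (p : T * T) : T * T :=
  match i with
  | None => p
  | Some true => (p.1, (p.1 * p.2^-1)%g)
  | Some false => (p.2, (p.1 * p.2^-1)%g)
  end.

(** The triangle on [a], [b], [c] is the corner (u, v), (ug, v), (ug, vg) of [E] with u = cb, v = b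
    and g = b^-1 c^-1 a. The case g = 1 gives back the points of [E]. *)
Definition corners T (E : {set T * T}) : R :=
  triangles (corner_fun E None) (corner_fun E (Some true)) (corner_fun E (Some false)).

Lemma corner_fun01 T (E : {set T * T}) i p : 0 <= corner_fun E i p <= 1.
Proof. by case: i => [[]|]; rewrite /= ler0n lern1 leq_b1. Qed.

Lemma side_inj T i : injective (@side T i).
Proof.
case: i => [[]|] [a b] [c d] //= [->]; last by move=> /mulIg ->.
by move=> /mulgI /invg_inj ->.
Qed.

Lemma corner_fun_side T (E : {set T * T}) i p :
  p \in E -> corner_fun E i (side i p) = 1.
Proof.
case: p => a b; case: i => [[]|] /= pE; last by rewrite pE.
- by rewrite invMg invgK mulgKV pE.
- by rewrite mulgKV pE.
Qed.

(** Refine [L] to a regular [M ++ L]. If this gains little energy, the refined means stay close to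
    the [L]-means on most boxes; some point of [E] then has all three sides good, and the triangles
    counted there with the refined means survive for [E] by regularity. *)
Lemma corners_ge_of_energy (a : R) (m : nat) : 0 < a ->
  exists K : nat, exists2 c : R, 0 < c & forall T (E : {set T * T}) L,
    (size L <= m)%N -> a * #|T|%:R ^+ 2 <= #|E|%:R ->
    c * #|T|%:R ^+ 3 <= corners E \/
    exists2 M, (size M <= K)%N &
      energy (corner_fun E) L + (a / 4 * ((a / 12) ^+ 2 / 24)) * #|T|%:R ^+ 2
        <= energy (corner_fun E) (M ++ L).
Proof.
(* Low density, small cells and energy gain each cost at most [a / 4] over the three edge types, for
   a total below [a]. *)
move=> a0; pose b := a / 12; pose g := b ^+ 2 / 24.
pose t : R := a / (24 * (2 ^ m)%:R).
have b0 : 0 < b by rewrite divr_gt0.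
have g0 : 0 < g by rewrite divr_gt0 // exprn_gt0.
have m0 : 0 < (2 ^ m)%:R :> R by rewrite ltr0n expn_gt0.
have t0 : 0 < t by rewrite divr_gt0 // mulr_gt0.
pose c := (b / 2) ^+ 3 / 4 * t ^+ 3.
have b20 : 0 < b / 2 by rewrite divr_gt0.
have c0 : 0 < c by apply: mulr_gt0; [apply: divr_gt0 => //|]; apply: exprn_gt0.
(* The box of the good point holds at least [2 * c * #|T| ^ 3] triangles and the three cut errors
   total [c * #|T| ^ 3]. The tolerance depends on [m] through [t], since it must be small against
   one box of [L]. *)
have [K regK] := exists_regular 3 (divr_gt0 c0 (ltr0n R 3)).
exists K, c => // T E L sL aE; set F := corner_fun E; set n : R := #|T|%:R.
have T0 : (0 < #|T|)%N by apply/card_gt0P; exists 1%g.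
have n0 : 0 < n by rewrite ltr0n.
have c3 : #|{: option bool}| = 3 by rewrite card_option card_bool.
have F01 : forall i p, 0 <= F i p <= 1 := @corner_fun01 T E.
have [M [sM rM]] := regK _ _ F L c3 T0 F01.
have [en|en] := leP (energy F L + (a / 4 * g) * n ^+ 2) (energy F (M ++ L)).
  by right; exists M.
left.
have small : #|{: option bool}|%:R * (b + 2 * t * (2 ^ size L)%:R) + g^-1 * (a / 4 * g) < a.
  have -> : g^-1 * (a / 4 * g) = a / 4 by field; rewrite lt0r_neq0.
  have le2 : t * (2 ^ size L)%:R <= a / 24.
    apply: (@le_trans _ _ (t * (2 ^ m)%:R)).
      by rewrite ler_pM2l // ler_nat leq_exp2l.
    by rewrite /t invfM mulrA mulfVK // lt0r_neq0.
  by rewrite c3 /b; lra.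
have [p pE gp] := exists_good_point F01 b0 g0 t0 T0 (@side_inj T) (@corner_fun_side T E) (ltW en) small aE.
pose G i := box_mean F (M ++ L) i.
have G01 i q : 0 <= G i q <= 1 by apply: box_mean01.
have G0 i q : 0 <= G i q by case/andP: (G01 i q).
have dev i (x y : T) : good_at F b g t L M i (x, y) ->
   b <= box_mean F L i (x, y) /\
   \sum_(q in setX (cell L x) (cell L y)) (G i q - box_mean F L i (x, y)) ^+ 2
     <= g * #|setX (cell L x) (cell L y)|%:R.
  case/and4P => bm dv _ _; split => //.
  rewrite -(class_same_box L (x, y)).
  have -> : \sum_(q in class_of (same_box L) (x, y)) (G i q - box_mean F L i (x, y)) ^+ 2
    = \sum_(q in class_of (same_box L) (x, y)) (G i q - box_mean F L i q) ^+ 2.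
    apply: eq_bigr => q; rewrite inE => h.
    by rewrite /box_mean (cexp_invariant (same_box_equiv L) _ h).
  by rewrite (sum_class_cexp (same_box_equiv L)) ler_pM2r // card_class_gt0 //; apply: same_box_equiv.
have [d0 v0] := dev _ _ _ (gp None).
have [d1 v1] := dev _ _ _ (gp (Some true)).
have [d2 v2] := dev _ _ _ (gp (Some false)).
have := triangles_box_ge b0 (G0 _) (G0 _) (G0 _) d0 d1 d2 v0 v1 v2.
have /and4P[_ _ tx ty] := gp None; have /and4P[_ _ _ tz] := gp (Some true).
move: tx ty tz; rewrite /= -/n => tx ty tz.
set U := #|_|%:R in tx *; set W := #|_|%:R in ty *; set Z := #|_|%:R in tz *.
have tn0 : 0 <= t * n by rewrite mulr_ge0 ?ltW.
have : (t * n) ^+ 3 <= U * W * Z.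
  rewrite !exprSr expr0 mul1r; apply: ler_pM => //; first exact: mulr_ge0.
  exact: ler_pM.
move=> UWZ low.
have cut i : forall S S' : {set T},
    \sum_(q in setX S S') (G i q - F i q) <= c / 3 * n ^+ 2.
  by move=> S S'; have /forallP/(_ i)/forallP/(_ S)/forallP/(_ S') := rM.
have := triangles_le (F01 _) (F01 _) (G01 _) (G01 _) (cut None) (cut (Some true)) (cut (Some false)).
rewrite -/(corners E) -/n => up.
have : (b / 2) ^+ 3 / 2 * (t * n) ^+ 3 <= corners E + 3 * (c / 3 * n ^+ 2) * n.
  apply: le_trans (le_trans low up); rewrite ler_pM2l //.
  by rewrite divr_gt0 // exprn_gt0 // divr_gt0.
have -> : (b / 2) ^+ 3 / 2 * (t * n) ^+ 3 = 2 * (c * n ^+ 3) by rewrite /c; field.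
have -> : 3 * (c / 3 * n ^+ 2) * n = c * n ^+ 3 by field.
by lra.
Qed.

(** Iterate the dichotomy from the trivial partition. The energy never exceeds [3 * #|T| ^ 2], so a
    gain of [eta * #|T| ^ 2] cannot occur [N > 3 / eta] times; list lengths and constants stay
    uniform in [T] and [E]. *)
Theorem corners_density (a : R) : 0 < a ->
  exists2 c : R, 0 < c & forall T (E : {set T * T}),
    a * #|T|%:R ^+ 2 <= #|E|%:R -> c * #|T|%:R ^+ 3 <= corners E.
Proof.
move=> a0; pose eta := a / 4 * ((a / 12) ^+ 2 / 24).
have eta0 : 0 < eta by rewrite mulr_gt0 ?divr_gt0 // exprn_gt0 // divr_gt0.
pose N := (Num.truncn (3 / eta)).+1.
have : exists m : nat, exists2 c : R, 0 < c & forall T (E : {set T * T}),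
    a * #|T|%:R ^+ 2 <= #|E|%:R -> c * #|T|%:R ^+ 3 <= corners E \/
    exists2 L, (size L <= m)%N & N%:R * eta * #|T|%:R ^+ 2 <= energy (corner_fun E) L.
  elim: N => [|N [m [c c0 IH]]].
    exists 0%N, 1 => // T E _; right; exists [::] => //.
    by rewrite !mul0r; apply: sumr_ge0 => i _; apply: sumr_ge0 => p _; apply: sqr_ge0.
  have [K [c' c'0 step]] := corners_ge_of_energy m a0.
  exists (K + m)%N, (Num.min c c') => [|T E aE]; first by rewrite lt_min c0.
  have n0 : 0 <= #|T|%:R ^+ 3 :> R by rewrite exprn_ge0 ?ler0n.
  case: (IH T E aE) => [h|[L sL eL]].
    by left; apply: le_trans h; rewrite ler_wpM2r // ge_min lexx.
  case: (step T E L sL aE) => [h|[M sM eM]].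
    by left; apply: le_trans h; rewrite ler_wpM2r // ge_min lexx orbT.
  right; exists (M ++ L); first by rewrite size_cat leq_add.
  apply: le_trans eM; rewrite -/eta -natr1 !mulrDl mul1r.
  by rewrite lerD2r.
case=> m [c c0 main]; exists c => // T E aE.
case: (main T E aE) => // -[L _ eL]; exfalso.
have := le_trans eL (energy_le (@corner_fun01 T E) L).
rewrite card_option card_bool ler_pM2r; last first.
  by rewrite exprn_gt0 // ltr0n; apply/card_gt0P; exists 1%g.
by rewrite leNgt -ltr_pdivrMr // truncnS_gt.
Qed.

End Corners.

(** * Elements popular for all dense sets at once, and the choice of a colour *)

Section Popular.
Variables (R : archiRealFieldType) (k : nat).

Section Counting.
Variables (T : finGroupType) (A : 'I_k -> {set T}).

(** Membership of [x] in [B] is left open: popularity is first shown for several sets at once, and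
    pigeonhole then places [x] in one of them. *)
Definition partners (B : {set T}) (x : T) : {set T} :=
  [set y | [&& y \in B, (y * x)%g \in B & (x * y)%g \in B]].

Definition twisted_grid (h : {ffun 'I_k -> T}) : {set T * T} :=
  [set p | [forall j, (p.1^-1 * h j * p.2)%g \in A j]].

(** The coordinates of [h] are independent, and each [s j] is a permutation of [T], so it preserves
    the size of [B j]. *)
Lemma card_ffun_forall (B : 'I_k -> {set T}) (s : 'I_k -> T -> T) :
  (forall j, injective (s j)) ->
  \sum_(h : {ffun 'I_k -> T}) ([forall j, s j (h j) \in B j])%:R
    = \prod_j #|B j|%:R :> R.
Proof.
move=> sI; transitivity (#|family (fun j => mem (s j @^-1: B j))|%:R : R).
  rewrite -sum1_card natr_sum [RHS]big_mkcond; apply: eq_bigr => h _ /=.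
  rewrite (_ : [forall j, _] = (h \in family (fun j => mem (s j @^-1: B j)))).
    by case: (_ \in _).
  apply/forallP/familyP => H j; first by rewrite inE.
  by have := H j; rewrite inE.
rewrite card_family foldrE big_map big_enum natr_prod.
by apply: eq_bigr => j _; rewrite card_preimset.
Qed.

Lemma sum_card_twisted_grid :
  \sum_h #|twisted_grid h|%:R = #|T|%:R ^+ 2 * \prod_j #|A j|%:R :> R.
Proof.
transitivity (\sum_(p : T * T) \prod_j #|A j|%:R : R); last first.
  by rewrite sumr_const card_prod -[LHS]mulr_natl natrM.
transitivity (\sum_(h : {ffun 'I_k -> T}) \sum_(p : T * T) ([forall j, (p.1^-1 * h j * p.2)%g \in A j])%:R : R).
  apply: eq_bigr => h _; rewrite -sum1_card natr_sum big_mkcond.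
  by apply: eq_bigr => p _; rewrite inE; case: ifP.
rewrite exchange_big; apply: eq_bigr => p _ /=.
apply: (@card_ffun_forall A (fun j x => (p.1^-1 * x * p.2)%g)).
by move=> _ x y /mulIg /mulgI.
Qed.

(** Put g = b^-1 c^-1 a and y_j = a^-1 h_j b. The three edges say that y_j, y_j g and g y_j lie in
    [A j]; for fixed a, b the map from c to g is bijective, and for fixed g the y_j range
    independently over [T]. *)
Lemma sum_corners_twisted_grid :
  \sum_h corners R (twisted_grid h)
    = #|T|%:R ^+ 2 * \sum_g \prod_j #|partners (A j) g|%:R.
Proof.
rewrite /corners /triangles exchange_big /=.
transitivity (\sum_(a : T) \sum_(b : T) \sum_g \prod_j #|partners (A j) g|%:R : R); last first.
  rewrite !sumr_const -!mulrnA -[LHS]mulr_natl; congr (_ * _).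
  by rewrite natrM expr2.
apply: eq_bigr => a _; rewrite exchange_big; apply: eq_bigr => b _ /=.
rewrite exchange_big [RHS](reindex (fun c => b^-1 * c^-1 * a)%g) /=; last first.
  exists (fun g => a * g^-1 * b^-1)%g => g _; rewrite !invMg ?invgK ?mulgA.
    by rewrite mulgV mul1g mulgK.
  by rewrite mulVg mul1g mulgKV.
apply: eq_bigr => c _.
rewrite -(@card_ffun_forall _ (fun j x => a^-1 * x * b)%g); last first.
  by move=> _ x y /mulIg /mulgI.
apply: eq_bigr => h _; rewrite -!natrM !mulnb; congr (_ %:R); congr nat_of_bool.
rewrite !inE /=.
apply/idP/idP => [/andP[/andP[/forallP h1 /forallP h2] /forallP h3]|/forallP H].
  apply/forallP => j; rewrite inE; apply/and3P; split=> //.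
    by have := h2 j; rewrite !mulgA mulgK.
  by have := h3 j; rewrite invMg !mulgA mulgK.
rewrite -andbA; apply/and3P; split; apply/forallP => j; have := H j; rewrite inE => /and3P[h1 h2 h3] //.
  by move: h2; rewrite !mulgA mulgK.
by move: h3; rewrite invMg !mulgA mulgK.
Qed.

End Counting.

Lemma corners_ge0 (T : finGroupType) (E : {set T * T}) : 0 <= corners R E.
Proof. by do 3!(apply: sumr_ge0 => ? _); rewrite !mulr_ge0 ?ler0n. Qed.

(** The grids have average density at least [a ^ k], so many are dense and contain many corners.
    Hence the product of the partner densities is large on average over [g], and a product of
    numbers in [0, 1] is large only if every factor is. *)
Lemma many_popular (a : R) : 0 < a ->
  exists2 d : R, 0 < d & forall (T : finGroupType) (A : 'I_k -> {set T}),
    (forall j, a * #|T|%:R <= #|A j|%:R) ->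
    d * #|T|%:R <= #|[set x | [forall j, d * #|T|%:R <= #|partners (A j) x|%:R]]|%:R.
Proof.
move=> a0; pose a' := a ^+ k / 2.
have a'0 : 0 < a' by rewrite divr_gt0 // exprn_gt0.
have [c c0 cornersP] := corners_density a'0.
(* The products sum to at least [2 * d * n]; the unpopular [g] account for at most [d * n], which
   leaves [d * n] for [X]. *)
pose d := a' * c / 2.
have d0 : 0 < d by apply: divr_gt0 => //; apply: mulr_gt0.
exists d => // T A dA; set n : R := #|T|%:R; set X := [set x | _].
have n0 : 0 < n by rewrite ltr0n; apply/card_gt0P; exists 1%g.
pose H := [set h | a' * n ^+ 2 <= #|twisted_grid A h|%:R].
have cH : a' * n ^+ k <= #|H|%:R.
  (* Reverse Markov: grids in [H] have at most [n ^ 2] points and the others fewer than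
     [a' * n ^ 2], while the total is at least [2 * a' * n ^ (k + 2)]. *)
  have : \sum_h #|twisted_grid A h|%:R <= n ^+ 2 * (#|H|%:R + a' * n ^+ k).
    apply: (@le_trans _ _ (\sum_(h : {ffun 'I_k -> T}) (n ^+ 2 * (h \in H)%:R + n ^+ 2 * a'))).
      apply: ler_sum => h _; rewrite inE.
      have [h2|h2] := leP (a' * n ^+ 2) #|twisted_grid A h|%:R; last first.
        by rewrite mulr0 add0r mulrC ltW.
      rewrite mulr1 (@le_trans _ _ (n ^+ 2)) //.
        by rewrite /n -natrX ler_nat -mulnn -card_prod max_card.
      by rewrite lerDl; apply: mulr_ge0; rewrite ?exprn_ge0 // ltW.
    rewrite big_split /= sumr_const card_ffun card_ord -mulr_sumr mulrDr lerD //.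
      rewrite ler_pM2l ?exprn_gt0 // -sum1_card natr_sum [leRHS]big_mkcond.
      by apply: ler_sum => h _; case: ifP.
    by rewrite -[leLHS]mulr_natr natrX mulrA.
  rewrite sum_card_twisted_grid -/n ler_pM2l ?exprn_gt0 // => le1.
  have : (a * n) ^+ k <= \prod_j #|A j|%:R.
    rewrite -{1}(card_ord k) -prodr_const; apply: ler_prod => j _.
    by rewrite dA mulr_ge0 // ltW.
  move=> le2; have := le_trans le2 le1; rewrite exprMn.
  have -> : a ^+ k = 2 * a' by rewrite /a'; field.
  by lra.
have low : a' * c * n ^+ k * n ^+ 3 <= n ^+ 2 * \sum_g \prod_j #|partners (A j) g|%:R.
  rewrite -sum_corners_twisted_grid.
  apply: (@le_trans _ _ (\sum_(h in H) c * n ^+ 3)).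
    rewrite sumr_const -[leRHS]mulr_natl.
    have : 0 <= c * n ^+ 3 * (#|H|%:R - a' * n ^+ k).
      by rewrite mulr_ge0 ?subr_ge0 // mulr_ge0 ?exprn_ge0 // ltW.
    by lra.
  rewrite big_mkcond; apply: ler_sum => h _; case: ifP => hH; last exact: corners_ge0.
  by apply: cornersP; rewrite inE in hH.
pose q j g : R := #|partners (A j) g|%:R / n.
have q0 j g : 0 <= q j g by rewrite divr_ge0 ?ler0n.
have q1 j g : q j g <= 1 by rewrite ler_pdivrMr // mul1r ler_nat max_card.
have up : \sum_g \prod_j q j g <= #|X|%:R + d * n.
  apply: (@le_trans _ _ (\sum_g ((g \in X)%:R + d))); last first.
    rewrite big_split /= sumr_const -[d *+ _]mulr_natr lerD2r.
    rewrite -sum1_card natr_sum [leRHS]big_mkcond.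
    by apply: ler_sum => g _; case: ifP.
  apply: ler_sum => g _; case: (boolP (g \in X)) => gX.
    rewrite (@le_trans _ _ 1) ?lerDl ?(ltW d0) //.
    by apply: prodr_ile1 => j _; rewrite q0 q1.
  move: gX; rewrite inE => /forallPn[j]; rewrite -ltNge => gj.
  rewrite add0r (bigD1 j) //=.
  apply: (@le_trans _ _ (q j g)); last by rewrite ler_pdivrMr // ltW.
  by rewrite ler_piMr //; apply: prodr_ile1 => i _; rewrite q0 q1.
have qE : \sum_g \prod_j #|partners (A j) g|%:R = n ^+ k * \sum_g \prod_j q j g.
  rewrite mulr_sumr; apply: eq_bigr => g _.
  have -> : n ^+ k = \prod_(j < k) n by rewrite prodr_const card_ord.
  rewrite -big_split /=; apply: eq_bigr => j _.
  by rewrite mulrC mulfVK // lt0r_neq0.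
move: low; rewrite qE mulrA.
have -> : a' * c * n ^+ k * n ^+ 3 = n ^+ 2 * n ^+ k * (2 * d * n) by rewrite /d; field.
rewrite ler_pM2l ?mulr_gt0 ?exprn_gt0 // => low.
have := le_trans low up; lra.
Qed.

(** Induction on a strict bound for the number of sparse sets. If a set has density between [a'] and
    [a], lowering the threshold to [a'] makes it dense. Otherwise sparse sets have density below
    [e], so a set that captures a proportion [e] of popular elements is dense, and popularity
    applies to it. *)
Lemma exists_rich_colour (m : nat) (a : R) : 0 < a -> a <= 1 ->
  exists2 c : R, 0 < c & forall (T : finGroupType) (A : 'I_k -> {set T}),
    (forall x, exists j, x \in A j) ->
    (#|[set j | (#|A j|%:R < a * #|T|%:R)%R]| < m)%N ->
    exists j, c * #|T|%:R ^+ 2 <= #|product_pairs (A j)|%:R.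
Proof.
elim: m a => [|m IH] a a0 a1; first by exists 1.
have [d d0 popular] := many_popular a0.
(* This gives [k * e < d], so the [k] sets cannot cover [X] while each meets it in fewer than
   [e * n] points. *)
pose e := d / (2 * k.+1%:R).
have e0 : 0 < e by rewrite divr_gt0 // mulr_gt0 ?ltr0n.
pose a' := Num.min a e.
have a'0 : 0 < a' by rewrite lt_min a0.
have a'a : a' <= a by rewrite ge_min lexx.
have [c c0 IHc] := IH _ a'0 (le_trans a'a a1).
exists (Num.min c (e * d)) => [|T A Acov sparse].
  by rewrite lt_min c0 mulr_gt0.
set n : R := #|T|%:R in sparse *.
have n0 : 0 < n by rewrite ltr0n; apply/card_gt0P; exists 1%g.
have [/existsP[i /andP[i1 i2]]|/existsPn gap] :=
  boolP [exists j, (#|A j|%:R < a * n) && (a' * n <= #|A j|%:R)].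
  have [//|j jc] := IHc T A Acov; last first.
    exists j; apply: le_trans jc; rewrite ler_wpM2r ?exprn_ge0 ?(ltW n0) //.
    by rewrite ge_min lexx.
  rewrite -/n -ltnS; apply: leq_trans sparse; rewrite ltnS; apply: proper_card.
  apply/properP; split; last first.
    by exists i; rewrite inE // -leNgt.
  apply/subsetP => j; rewrite !inE => /lt_le_trans; apply.
  by rewrite ler_wpM2r // ltW.
(* Filling the sparse coordinates with the whole group keeps all [k] densities at least [a], by
   [a <= 1], and puts no constraint on partners there. *)
pose B j := if a * n <= #|A j|%:R then A j else setT.
have dB j : a * n <= #|B j|%:R.
  by rewrite /B; case: ifP => // _; rewrite cardsT -/n ler_piMl // ltW.
have := popular T B dB; rewrite -/n; set X := [set x | _] => cX.
have [/existsP[j jX]|/existsPn few] := boolP [exists j, e * n <= #|X :&: A j|%:R].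
  have dense : a * n <= #|A j|%:R.
    have := gap j; rewrite negb_and -leNgt -ltNge => /orP[//|lt].
    exfalso; have : #|X :&: A j|%:R < e * n; last by rewrite ltNge jX.
    apply: (@le_lt_trans _ _ #|A j|%:R); first by rewrite ler_nat subset_leq_card // subsetIr.
    by apply: lt_le_trans lt _; rewrite ler_pM2r // ge_min lexx orbT.
  exists j; apply: (@le_trans _ _ ((e * n) * (d * n))).
    rewrite mulrACA -expr2 ler_wpM2r ?exprn_ge0 ?(ltW n0) //.
    by rewrite ge_min lexx orbT.
  apply: (@le_trans _ _ (\sum_(x in X :&: A j) d * n)).
    by rewrite sumr_const -[leRHS]mulr_natl ler_wpM2r // ltW // mulr_gt0.
  apply: (@le_trans _ _ (\sum_(x in X :&: A j) #|partners (A j) x|%:R)).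
    apply: ler_sum => x; rewrite !inE => /andP[/forallP /(_ j) + _].
    by rewrite /B dense.
  rewrite -natr_sum ler_nat.
  have -> : \sum_(x in X :&: A j) #|partners (A j) x| =
     #|[set p : T * T | (p.1 \in X :&: A j) && (p.2 \in partners (A j) p.1)]|.
    rewrite -sum1_card.
    under [LHS]eq_bigr do rewrite -sum1_card.
    by rewrite pair_big_dep /=; apply: eq_bigl => p; rewrite [RHS]inE.
  apply: subset_leq_card; apply/subsetP => -[x y].
  rewrite !inE /= => /andP[/andP[_ xA] /and3P[yA yxA xyA]].
  by rewrite xA yA yxA xyA.
exfalso; have : #|X|%:R <= k%:R * (e * n).
  apply: (@le_trans _ _ (\sum_j #|X :&: A j|%:R)); last first.
    rewrite -[k in k%:R]card_ord mulr_natl -sumr_const; apply: ler_sum => j _.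
    by have := few j; rewrite -ltNge => /ltW.
  rewrite -natr_sum ler_nat.
  apply: leq_trans (_ : #|\bigcup_j (X :&: A j)| <= _)%N.
    apply: subset_leq_card; apply/subsetP => x xX.
    have [j xj] := Acov x; apply/bigcupP; exists j => //.
    by rewrite in_setI xX.
  elim/big_rec2 : _ => [|j s S _ sS]; first by rewrite cards0.
  by apply: leq_trans (leq_card_setU _ _) _; rewrite leq_add2l.
apply/negP; rewrite -ltNge; apply: lt_le_trans cX.
rewrite mulrA ltr_pM2r // /e mulrA ltr_pdivrMr ?mulr_gt0 ?ltr0n //.
rewrite -natr1; have := ler0n R k; nra.
Qed.

End Popular.

Theorem theorem1p2 (R : realType) (k : nat) (k_gt0 : (0 < k)%N) :
  exists c : R, 0 < c /\
    forall (gT : finGroupType) (G : {group gT}) (C : {set {set gT}}),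
      #|C| = k -> cover C = G ->
      exists A : {set gT}, A \in C /\
        c * #|G|%:R ^+ 2 <= #|product_pairs A|%:R.
Proof.
(* Start at density threshold [1]: whatever the cover, at most [k] sets are sparse. *)
have [c c0 main] := exists_rich_colour k k.+1 ltr01 (lexx (1 : R)).
exists c; split=> // gT G C Ck CG.
rewrite -{}Ck in main *.
(* The cover is pulled back to the type [subg_of G], where the group is the whole type; pairs are
   carried back along the injective morphism [sgval]. *)
pose A (j : 'I_#|C|) : {set subg_of G} := sgval @^-1: enum_val j.
have Acov x : exists j, x \in A j.
  have : sgval x \in cover C by rewrite CG subgP.
  case/bigcupP => B BC xB; exists (enum_rank_in BC B).
  by rewrite inE enum_rankK_in.
have [|j] := main (subg_of G) A Acov.
  by rewrite ltnS; apply: leq_trans (max_card _) _; rewrite card_ord.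
have -> : #|{: subg_of G}| = #|G|.
  rewrite -cardsT -(card_imset _ (@subg_inj _ G)); congr #|pred_of_set _|.
  apply/setP=> x; apply/imsetP/idP => [[y _ ->]|xG]; first exact: subgP.
  by exists (subg G x); rewrite ?inE ?subgK.
move=> jc; exists (enum_val j); split; first exact: enum_valP.
apply: le_trans jc _; rewrite ler_nat.
pose f (p : subg_of G * subg_of G) := (sgval p.1, sgval p.2).
have fI : injective f by move=> [x y] [z t] [/val_inj -> /val_inj ->].
rewrite -(card_imset _ fI); apply: subset_leq_card.
apply/subsetP => _ /imsetP[[x y] + ->]; rewrite !inE /= => /and4P[-> -> xy yx].
by rewrite xy yx.
Qed.
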